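(* Let $S$ be a countable collection of (nonempty) shifts. Then $\mathsf{DS}^{\mathsf{ef}}(S)$ is an algebroidal category and its category-theoretically finite objects are, up to isomorphism, exactly those that are in $S$. Moreover, $\mathsf{DS}^{\mathsf{ef}}(S)$ contains a $\mathsf{DS}^{\mathsf{ef}}(S)$-universal and $S$-homogeneous deterministic system $(U,T)$ if and only if both: (1) if $X_0,X_1\in S$, there is $Y\in S$ and there are factors $f_0:Y\to X_0$ and $f_1:Y\to X_1$; and (2) if $X,Y_0,Y_1\in S$ and $f_0:Y_0\to X$ and $f_1:Y_1\to X$ are factors, then there is $Z\in S$ and there are factors $g_0:Z\to Y_0$ and $g_1:Z\to Y_1$ such that $f_0\circ g_0=f_1\circ g_1$.
   Context: Deterministic systems. A deterministic system is a pair $(X,T)$ with $X$ a zero-dimensional (having a basis of clopen sets), second-countable, compact Hausdorff space and $T:X\to X$ continuous. A factor $f:(Y,S)\to(X,T)$ is a continuous surjection with $f\circ S=T\circ f$. An embedding-factor pair (ef-pair) $(e,f):(X,T)\to(Y,S)$ consists of a factor $f:(Y,S)\to(X,T)$ together with the multifunction $e:x\mapsto f^{-1}(x)$ from $X$ to $Y$ (the embedding uniquely determined by $f$); composition is $(e',f')\circ(e,f)=(e'\circ e,f\circ f')$. $\mathsf{detSys}^{\mathsf{ef}}$ is the category of nonempty deterministic systems with ef-pairs as morphisms (so a morphism $(X,T)\to(Y,S)$ amounts to a factor $(Y,S)\to(X,T)$). A shift is a closed subset $X\subseteq A^\omega$ for some finite alphabet $A$ (with $A^\omega$ carrying the product of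 discrete topologies) such that $\sigma[X]\subseteq X$, where $\sigma(x)_n=x_{n+1}$; it is regarded as the system $(X,\sigma)$. $\mathsf{DS}^{\mathsf{ef}}(S)$ is the full subcategory of $\mathsf{detSys}^{\mathsf{ef}}$ consisting of those objects that are colimits of $\omega$-chains of shifts in $S$. Category theory. An $\omega$-chain in a category $\mathsf{C}$ is a sequence of objects $A_i$ with morphisms $A_i\to A_{i+1}$ ($i\in\omega$). An object $B$ of $\mathsf{C}$ is (category-theoretically) finite if for every $\omega$-chain with colimit $(A,f_i)$ and every morphism $g:B\to A$ there is $n$ such that for all $i\geq n$ there is a unique morphism $h:B\to A_i$ with $g=f_i\circ h$. $\mathsf{C}$ is semi-algebroidal if all its morphisms are monic, every object is a colimit of an $\omega$-chain of finite objects, and every $\omega$-chain of finite objects has a colimit in $\mathsf{C}$. $\mathsf{C}$ is algebroidal if it is semi-algebroidal, has up to isomorphism only countably many finite objects, and has only countably many morphisms between any two finite objects. For a full subcategory $\mathsf{D}$ of $\mathsf{C}$, an object $U$ of $\mathsf{C}$ is $\mathsf{D}$-universal if for every object $A$ of $\mathsf{D}$ there is a morphism $A\to U$; it is $\mathsf{D}$-homogeneous if for every object $A$ of $\mathsf{D}$ and all morphisms $f,g:A\to U$ there is an isomorphism $h:U\to U$ with $h\circ g=f$. $S$ is identified with the full subcategory on its elements.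
   Formalization: The ''if and only if'' is stated only for a nonempty collection S: for empty S conditions (1) and (2) hold vacuously, but the category has no objects, so no (U,T) exists. The other claims cover every countable S. *)

(* Defs.v *)
From HB Require Import structures.
From mathcomp Require Import all_boot all_order all_algebra.
From mathcomp Require Import all_classical all_reals all_analysis.

Set Implicit Arguments.
Unset Strict Implicit.
Unset Printing Implicit Defensive.

Local Open Scope classical_set_scope.

(** The universe bound of [set T] and [countable] excludes the (large) types of
    all systems and of all shifts, so classes of these are plain predicates. *)
Definition countable_class (T : Type) (D : T -> Prop) : Prop :=
  exists f : T -> nat, forall x y, D x -> D y -> f x = f y -> x = y.

Record category := Category {
  obj :> Type;
  mor : obj -> obj -> Type;
  idm : forall X, mor X X;
  compm : forall X Y Z, mor Y Z -> mor X Y -> mor X Z;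
  comp1m : forall X Y (f : mor X Y), compm (idm Y) f = f;
  compm1 : forall X Y (f : mor X Y), compm f (idm X) = f;
  compmA : forall W X Y Z (h : mor Y Z) (g : mor X Y) (f : mor W X),
    compm h (compm g f) = compm (compm h g) f
}.

Definition full_subcategory (C : category) (P : C -> Prop) : category :=
  @Category {X : C | P X} (fun X Y => mor (sval X) (sval Y))
    (fun X => idm (sval X)) (fun X Y Z g f => compm g f)
    (fun X Y f => comp1m f) (fun X Y f => compm1 f)
    (fun W X Y Z h g f => compmA h g f).

Section CategoryTheory.
Context {C : category}.

Definition is_monic (X Y : C) (m : mor X Y) : Prop :=
  forall (W : C) (f g : mor W X), compm m f = compm m g -> f = g.

Definition is_iso (X Y : C) (f : mor X Y) : Prop :=
  exists g : mor Y X, compm g f = idm X /\ compm f g = idm Y.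

Definition isomorphic (X Y : C) : Prop := exists f : mor X Y, is_iso f.

End CategoryTheory.

Record chain (C : category) := Chain {
  chain_obj :> nat -> C;
  chain_map : forall i, mor (chain_obj i) (chain_obj i.+1)
}.

Section Colimits.
Context {C : category}.

Definition is_cocone (A : chain C) (L : C) (c : forall i, mor (A i) L) : Prop :=
  forall i, compm (c i.+1) (chain_map A i) = c i.

Definition is_colimit (A : chain C) (L : C) (c : forall i, mor (A i) L) : Prop :=
  is_cocone c /\
  forall (M : C) (d : forall i, mor (A i) M), is_cocone d ->
    exists! h : mor L M, forall i, compm h (c i) = d i.

Definition finite_object (B : C) : Prop :=
  forall (A : chain C) (L : C) (c : forall i, mor (A i) L), is_colimit c ->
  forall g : mor B L, exists n, forall i, n <= i ->
    exists! h : mor B (A i), g = compm (c i) h.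

End Colimits.

Definition semi_algebroidal (C : category) : Prop :=
  [/\ forall (X Y : C) (f : mor X Y), is_monic f,
      forall L : C, exists (A : chain C) (c : forall i, mor (A i) L),
        (forall i, finite_object (A i)) /\ is_colimit c &
      forall A : chain C, (forall i, finite_object (A i)) ->
        exists (L : C) (c : forall i, mor (A i) L), is_colimit c].

Definition algebroidal (C : category) : Prop :=
  [/\ semi_algebroidal C,
      exists2 D : C -> Prop, countable_class D &
        forall X : C, finite_object X -> exists2 Y, D Y & isomorphic X Y &
      forall X Y : C, finite_object X -> finite_object Y ->
        countable [set: mor X Y]].

(** A full subcategory [D] of [C] is given by its class of objects. *)
Definition universal (C : category) (D : C -> Prop) (U : C) : Prop :=
  forall A : C, D A -> inhabited (mor A U).

Definition homogeneous (C : category) (D : C -> Prop) (U : C) : Prop :=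
  forall A : C, D A -> forall f g : mor A U,
    exists h : mor U U, is_iso h /\ compm h g = f.

(** The library's [zero_dimensional] only asks that clopen sets separate
    points, hence this definition. *)
Definition clopen_basis (X : topologicalType) : Prop :=
  exists2 B : set (set X), basis B & B `<=` clopen.

Record detSys := DetSys {
  space :> topologicalType;
  dyn : space -> space;
  detSys_zero_dim : clopen_basis space;
  detSys_second_countable : @second_countable space;
  detSys_compact : compact [set: space];
  detSys_hausdorff : hausdorff_space space;
  dyn_continuous : continuous dyn;
  detSys_nonempty : [set: space] !=set0
}.

Definition is_factor (Y X : detSys) (f : Y -> X) : Prop :=
  [/\ continuous f, forall x, exists y, f y = x &
      forall y, f (dyn y) = dyn (f y)].

Record efpair (X Y : detSys) := EFPair {
  emb : X -> set Y;
  fac : Y -> X;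
  fac_factor : is_factor fac;
  embE : emb = fun x => fac @^-1` [set x]
}.

Lemma efpair_eq (X Y : detSys) (p q : efpair X Y) : fac p = fac q -> p = q.
Proof.
case: p q => [e f Ff Ee] [e' f' Ff' Ee'] /= eqf; subst f' e e'.
by rewrite (Prop_irrelevance Ff Ff').
Qed.

Lemma is_factor_id (X : detSys) : is_factor (fun x : X => x).
Proof. by split => // [|x]; [move=> x; exact: cvg_id | exists x]. Qed.

Lemma is_factor_comp (X Y Z : detSys) (f : Y -> X) (g : Z -> Y) :
  is_factor f -> is_factor g -> is_factor (f \o g).
Proof.
move=> [cf sf ef] [cg sg eg]; split => [z|x|z] /=.
- exact: continuous_comp (cg z) (cf (g z)).
- by have [y <-] := sf x; have [z <-] := sg y; exists z.
- by rewrite eg ef.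
Qed.

Lemma efpair_id_embE (X : detSys) :
  (fun x : X => [set x]) = (fun x => (fun y : X => y) @^-1` [set x]).
Proof. by []. Qed.

Definition efpair_id (X : detSys) : efpair X X :=
  EFPair (is_factor_id X) (efpair_id_embE X).

Lemma efpair_comp_embE (X Y Z : detSys) (q : efpair Y Z) (p : efpair X Y) :
  (fun x => \bigcup_(y in emb p x) emb q y) =
  (fun x => (fac p \o fac q) @^-1` [set x]).
Proof.
apply/funext => x; rewrite !embE; apply/seteqP; split => [z [y /= <- <-]//|z /= h].
by exists (fac q z).
Qed.

Definition efpair_comp (X Y Z : detSys) (q : efpair Y Z) (p : efpair X Y) :
    efpair X Z :=
  EFPair (is_factor_comp (fac_factor p) (fac_factor q)) (efpair_comp_embE q p).

Lemma efpair_comp1m (X Y : detSys) (p : efpair X Y) :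
  efpair_comp (efpair_id Y) p = p.
Proof. exact: efpair_eq. Qed.

Lemma efpair_compm1 (X Y : detSys) (p : efpair X Y) :
  efpair_comp p (efpair_id X) = p.
Proof. exact: efpair_eq. Qed.

Lemma efpair_compmA (W X Y Z : detSys)
    (r : efpair Y Z) (q : efpair X Y) (p : efpair W X) :
  efpair_comp r (efpair_comp q p) = efpair_comp (efpair_comp r q) p.
Proof. exact: efpair_eq. Qed.

Definition detSysEf : category :=
  Category efpair_comp1m efpair_compm1 efpair_compmA.

Definition seqs (A : finType) : topologicalType :=
  {ptws nat -> discrete_topology A}.

Definition shift_map (A : finType) (x : seqs A) : seqs A := fun n => x n.+1.

Record shift_space := Shift {
  alphabet : finType;
  points : set (seqs alphabet);
  points_closed : closed points;
  points_invariant : @shift_map alphabet @` points `<=` points;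
  points_nonempty : points !=set0
}.

Arguments points : clear implicits.

Section ShiftSystem.
Variable X : shift_space.
Local Notation A := (alphabet X).
Local Notation P := (set_type (points X)).

Lemma shift_dyn_subproof (x : P) : @shift_map A (val x) \in points X.
Proof.
by apply/mem_set/points_invariant; exists (val x) => //; exact: set_valP.
Qed.

Definition shift_dyn (x : P) : P :=
  exist (fun y => y \in points X) _ (shift_dyn_subproof x).

Lemma val_points_continuous : continuous (fun x : P => val x : seqs A).
Proof. exact: (@initial_continuous P (seqs A) set_val). Qed.

Lemma coord_continuous (i : nat) :
  continuous (fun x : P => (val x : seqs A) i : discrete_topology A).
Proof.
move=> x; apply: (@continuous_comp _ _ _ _ (fun y : seqs A => y i)).
  exact: val_points_continuous.
exact: (@proj_continuous _ (fun=> discrete_topology A) i).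
Qed.

Lemma points_cvgP (F : set_system P) (x : P) {FF : Filter F} :
  (forall i, \forall y \near F, (val y : seqs A) i = (val x : seqs A) i) ->
  F --> x.
Proof.
move=> Fx U /=; rewrite nbhsE => -[_ [[V oV <-] Vx] /filterS]; apply.
suff : (fun y : P => val y : seqs A) @ F --> (val x : seqs A).
  by apply; exact: open_nbhs_nbhs.
apply/cvg_sup => i W.
have /= -> := @nbhsE (initial_topology (fun f : seqs A => f i)) (val x).
move=> [_ [[B oB <-] Bx] BW].
apply: (filterS _ (Fx i)) => y yx; apply: BW; rewrite /preimage /=.
by rewrite [X in B X]yx.
Qed.

Lemma shift_dyn_continuous : continuous shift_dyn.
Proof.
move=> x.
apply: (@points_cvgP _ _ (fmap_filter shift_dyn (nbhs_filter x))) => i.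
have := @discrete_set1 (discrete_topology A) ((val x : seqs A) i.+1).
exact: (@coord_continuous i.+1 x).
Qed.

Let cyl (s : seq A) : set P := [set x | mkseq (val x : seqs A) (size s) = s].

Lemma near_prefix (x : P) n :
  \forall y \near x, mkseq (val y : seqs A) n = mkseq (val x : seqs A) n.
Proof.
elim: n => [|n IH]; first by apply: filterS filterT.
have Hn : \forall y \near x, (val y : seqs A) n = (val x : seqs A) n.
  have := @discrete_set1 (discrete_topology A) ((val x : seqs A) n).
  exact: (@coord_continuous n x).
near=> y; rewrite /mkseq -addn1 iotaD !map_cat /=; congr (_ ++ [:: _]).
  by near: y.
by near: y.
Unshelve. all: by end_near.
Qed.

Lemma cyl_open s : open (cyl s).
Proof.
rewrite openE => x xs; rewrite /interior /=.
by apply: filterS (near_prefix x (size s)) => y yx; exact: etrans yx xs.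
Qed.

Lemma cyl_clopen s : clopen (cyl s).
Proof.
split; first exact: cyl_open.
rewrite -[cyl s]setCK closedC openE => x xs; rewrite /interior /=.
by apply: filterS (near_prefix x (size s)) => y yx ys; apply: xs;
  exact: etrans (esym yx) ys.
Qed.

Lemma cyl_basis : basis (range cyl).
Proof.
split; first by move=> _ [s _ <-]; exact: cyl_open.
move=> x; pose F := filter_from [set U | range cyl U /\ U x] id.
have FP n : F [set y | mkseq (val y : seqs A) n = mkseq (val x : seqs A) n].
  exists (cyl (mkseq (val x : seqs A) n)).
    by split; [eexists | rewrite /cyl /= size_mkseq].
  by move=> y; rewrite /cyl /= size_mkseq.
have FF : Filter F.
  apply: filter_from_filter; first by exists (cyl [::]); split => //; exists [::].
  move=> _ _ [[s _ <-] xs] [[t _ <-] xt].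
  exists (cyl (mkseq (val x : seqs A) (maxn (size s) (size t)))).
    by split; [eexists | rewrite /cyl /= size_mkseq].
  have sub (y : P) m n : m <= n ->
      mkseq (val y : seqs A) n = mkseq (val x : seqs A) n ->
      mkseq (val y : seqs A) m = mkseq (val x : seqs A) m.
    move=> mn /(congr1 (take m)).
    by rewrite /mkseq -!map_take take_iota (minn_idPl mn).
  move=> y; rewrite /cyl /= size_mkseq => yx; split => /=.
    by rewrite -[RHS]xs; apply: sub yx; exact: leq_maxl.
  by rewrite -[RHS]xt; apply: sub yx; exact: leq_maxr.
apply: points_cvgP => i.
apply: (filterS _ (FP i.+1)) => y /=.
rewrite /mkseq -addn1 iotaD !map_cat => /eqP.
by rewrite eqseq_cat ?size_map //= => /andP[_ /eqP[]].
Qed.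

Lemma shift_clopen_basis : clopen_basis P.
Proof.
by exists (range cyl); [exact: cyl_basis | move=> _ [s _ <-]; exact: cyl_clopen].
Qed.

Lemma shift_second_countable : @second_countable P.
Proof.
exists (range cyl); last exact: cyl_basis.
by apply: sub_countable (card_image_le _ _) _; exact: countableP.
Qed.

Lemma seqs_compact : compact [set: seqs A].
Proof.
have := @tychonoff _ (fun _ : nat => discrete_topology A) (fun=> setT).
have -> : [set f : nat -> discrete_topology A | forall i, setT (f i)] = setT.
  by apply/seteqP; split.
by apply => _; apply: finite_compact; exact: (@finite_finset A).
Qed.

Lemma shift_compact : compact [set: P].
Proof.
have cX : compact (points X).
  by apply: (subclosed_compact _ seqs_compact) => //; exact: points_closed.
move=> F PF _.
have [|p [Xp clp]] := cX ((fun x : P => val x : seqs A) @ F) _.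
  by apply: nearW => x; exact: set_valP.
pose x : P := exist (fun y => y \in points X) p (mem_set Xp).
exists x; split => // U V FU; rewrite nbhsE => -[_ [[W oW <-] Wx] WV].
have FW : F ((fun x : P => val x : seqs A) @^-1` (set_val @` U)).
  by apply: filterS FU => y Uy; exists y.
have [_ [[y Uy <-] Wy]] := clp _ _ FW (open_nbhs_nbhs (conj oW Wx)).
by exists y; split => //; exact: WV.
Qed.

Lemma shift_hausdorff : hausdorff_space P.
Proof.
move=> p q clpq; apply: val_inj; apply/funext => i.
have H (x : P) : \forall y \near x, (val y : seqs A) i = (val x : seqs A) i.
  have := @discrete_set1 (discrete_topology A) ((val x : seqs A) i).
  exact: (@coord_continuous i x).
by have [y [/= <- <-]] := clpq _ _ (H p) (H q).
Qed.

Lemma shift_nonempty : [set: P] !=set0.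
Proof.
by have [p Xp] := points_nonempty X; exists (exist _ p (mem_set Xp)).
Qed.

Definition shift_sys : detSys :=
  DetSys shift_clopen_basis shift_second_countable shift_compact
    shift_hausdorff shift_dyn_continuous shift_nonempty.

End ShiftSystem.

Definition chain_colimit_of_shifts (S : shift_space -> Prop) (L : detSysEf) : Prop :=
  exists (A : chain detSysEf) (c : forall i, mor (A i) L),
    (forall i, exists2 X, S X & A i = shift_sys X) /\ is_colimit c.

Definition DSef (S : shift_space -> Prop) : category :=
  full_subcategory (chain_colimit_of_shifts S).

(** A shift in [S] is the colimit of its constant chain. *)
Lemma shift_chain_colimit (S : shift_space -> Prop) (X : shift_space) :
  S X -> chain_colimit_of_shifts S (shift_sys X).
Proof.
move=> SX; pose E : detSysEf := shift_sys X.
exists (@Chain detSysEf (fun=> E) (fun=> idm E)), (fun=> idm E).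
split; first by move=> i; exists X.
split=> [i|M d dco]; first exact: compm1.
have d0 i : d 0 = d i.
  by elim: i => [//|i ->]; rewrite -[LHS]dco; exact: compm1.
exists (d 0); split => [i|h hd]; first by rewrite compm1.
by rewrite -(hd 0) compm1.
Qed.

Definition shift_obj (S : shift_space -> Prop) (X : shift_space) (SX : S X) : DSef S :=
  exist _ (shift_sys X) (shift_chain_colimit SX).

Definition shift_objs (S : shift_space -> Prop) (E : DSef S) : Prop :=
  exists (X : shift_space) (SX : S X), E = shift_obj SX.

Arguments shift_objs : clear implicits.

(* Main.v *)
(** An ef-pair is determined by its factor map, so the category is the opposite
    of the category of systems and factors, and all its morphisms are monic.  By
    compactness a cocone is a colimit in it exactly when its factor maps jointly
    separate points, i.e. when it is an inverse limit.  A factor map onto a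
    shift is determined by the zeroth letter, a locally constant function, and
    so it factors through some level of any inverse limit: shifts are finite
    objects.  A system is an inverse limit of shifts in [S] iff every
    neighbourhood of its diagonal contains the kernel of a factor map onto some
    shift in [S]; this yields closure under inverse limits.  The
    characterization of universal homogeneous objects is then the
    Fraisse-type theorem of Droste and Göbel: amalgamation is iterated along a
    chain that answers every extension problem posed on the way, and a
    back-and-forth argument gives homogeneity. *)

From Pilot Require Import Defs.
From HB Require Import structures.
From mathcomp Require Import all_boot all_order all_algebra.
From mathcomp Require Import all_classical all_reals all_analysis.

Set Implicit Arguments.
Unset Strict Implicit.
Unset Printing Implicit Defensive.

Local Open Scope classical_set_scope.

(** * Compactness and cones of factor maps *)

(** The [K n] generate a proper filter; a cluster point of it lies in each [K n] by closedness. *)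
Lemma compact_nested (T : topologicalType) (K : nat -> set T) :
    compact [set: T] -> (forall n, closed (K n)) -> (forall n, K n !=set0) ->
    (forall n, K n.+1 `<=` K n) ->
  exists x, forall n, K n x.
Proof.
move=> cT clK K0 Kdec.
have Kle m n : m <= n -> K n `<=` K m.
  elim: n => [|n IH]; first by rewrite leqn0 => /eqP->.
  rewrite leq_eqVlt ltnS => /orP[/eqP-> //|/IH mn].
  exact: subset_trans (Kdec n) mn.
have FF : ProperFilter (filter_from setT K).
  apply: filter_from_proper; last by move=> n _; exact: K0.
  apply: filter_from_filter; first by exists 0.
  move=> m n _ _; exists (maxn m n) => // x Kx.
  by split; [apply: Kle Kx; exact: leq_maxl | apply: Kle Kx; exact: leq_maxr].
have [|x [_ clx]] := cT _ FF _; first by exists 0.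
exists x => n; apply: (clK n) => B Bx.
by have [|y Ky] := clx (K n) B _ Bx; [exists n | exists y].
Qed.

Lemma closed_image (X Y : topologicalType) (f : X -> Y) (C : set X) :
  compact [set: X] -> hausdorff_space Y -> continuous f -> closed C ->
  closed (f @` C).
Proof.
move=> cX hY cf clC; apply: compact_closed => //.
apply: continuous_compact; first exact: continuous_subspaceT.
exact: subclosed_compact clC cX _.
Qed.

Lemma countable_clopen (X : detSys) : countable (@clopen X).
Proof.
have [x0 _] := detSys_nonempty X.
pose pX : ptopologicalType := HB.pack_for ptopologicalType (Defs.space X)
  (isPointed.Build (Defs.space X) x0).
exact: (@clopen_countable pX (@detSys_compact X) (@detSys_second_countable X)).
Qed.

Lemma clopen_separates (X : detSys) (x y : X) :
  x <> y -> exists U, [/\ clopen U, U x & ~ U y].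
Proof.
move=> xy; have [B [oB bB] clB] := detSys_zero_dim X.
have cly : closed [set y].
  apply: accessible_closed_set1; apply: hausdorff_accessible.
  exact: detSys_hausdorff.
have : nbhs x (~` [set y]).
  by apply: open_nbhs_nbhs; split; [exact: closed_openC | exact: xy].
move=> /(bB x) [U [BU Ux] Uy]; exists U; split => //; first exact: clB.
by move=> /Uy /=; apply.
Qed.

Lemma separating_clopens (X : detSys) :
  exists2 K : nat -> set X, forall n, clopen (K n) &
    forall x y, (forall n, K n x <-> K n y) -> x = y.
Proof.
have /countable_injP[code codeI] := countable_clopen X.
pose P n U := clopen U /\ code U = n.
(* [K n] is the clopen set with code [n]; numbers that code nothing get the empty set, which is
   clopen too. *)
pose K n := if pselect (exists U, P n U) is left h then sval (cid h) else set0.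
exists K => [n|x y Kxy].
  rewrite /K; case: pselect => [h|_]; last exact: clopen0.
  by case: (cid h) => U [].
apply: contrapT => /clopen_separates[U [clU Ux Uy]].
have UE : K (code U) = U.
  rewrite /K; case: pselect => [h|[]]; last by exists U.
  case: (cid h) => V [/= clV VU]; apply: codeI => //; exact/mem_set.
by apply: Uy; rewrite -UE; apply/Kxy; rewrite UE.
Qed.

Lemma closed_fiber (T : topologicalType) (X : detSys) (f : T -> X) (x : X) :
  continuous f -> closed (f @^-1` [set x]).
Proof.
move=> cf; apply: closed_comp => [? _|]; first exact: cf.
apply: accessible_closed_set1; apply: hausdorff_accessible.
exact: detSys_hausdorff.
Qed.

(** Continuous maps from compact to Hausdorff spaces are closed, so the surjection [f] is a quotient
    map, and [h] is continuous because [h \o f = g] is. *)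
Lemma factor_lift (L X Y : detSys) (f : L -> X) (g : L -> Y) :
    is_factor f -> is_factor g -> (forall x y, f x = f y -> g x = g y) ->
  exists2 h : X -> Y, is_factor h & g = h \o f.
Proof.
move=> [cf sf ef] [cg sg eg] fg.
(* [s] is a set-theoretic section of [f], not assumed continuous; by the kernel inclusion [g \o s]
   does not depend on its choice. *)
pose s x := sval (cid (sf x)); have sK x : f (s x) = x by rewrite /s; case: cid.
pose h := g \o s; have hE y : h (f y) = g y by apply: fg; rewrite sK.
exists h; last by apply/funext => y /=; rewrite hE.
split=> [|y|x].
- apply/continuous_closedP => C clC.
  have -> : h @^-1` C = f @` (g @^-1` C).
    apply/seteqP; split=> [x Cx|_ [y Cy <-]]; first by exists (s x); rewrite ?sK.
    by rewrite /= hE.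
  apply: closed_image => //; [exact: detSys_compact|exact: detSys_hausdorff|].
  exact: closed_comp (fun _ _ => cg _) clC.
- by have [z <-] := sg y; exists (f z).
- by rewrite -{1}(sK x) -ef hE eg -hE sK.
Qed.

Definition separating (A : chain detSysEf) (L : detSysEf)
    (c : forall i, mor (A i) L) : Prop :=
  forall x y : Defs.space L, (forall i, fac (c i) x = fac (c i) y) -> x = y.

Section Cone.
Variables (A : chain detSysEf) (L : detSysEf) (c : forall i, mor (A i) L).
Hypothesis cc : is_cocone c.

Lemma cocone_fac i (x : Defs.space L) : fac (chain_map A i) (fac (c i.+1) x) = fac (c i) x.
Proof. by rewrite -(cc i). Qed.

Lemma fiber_mono i j (x y : Defs.space L) : i <= j ->
  fac (c j) x = fac (c j) y -> fac (c i) x = fac (c i) y.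
Proof.
elim: j => [|j IH]; first by rewrite leqn0 => /eqP->.
rewrite leq_eqVlt ltnS => /orP[/eqP-> //|/IH mn] xy.
by apply: mn; rewrite -[LHS]cocone_fac -[RHS]cocone_fac xy.
Qed.

Hypothesis sc : separating c.

(** Compactness applied to the closed sets of pairs outside [E] that are
    identified by [c n]. *)
Lemma separating_fine (E : set (Defs.space L * Defs.space L)) :
    open E -> (forall x, E (x, x)) ->
  exists n, forall i, n <= i ->
    forall x y, fac (c i) x = fac (c i) y -> E (x, y).
Proof.
move=> oE diagE; apply: contrapT => noE.
have nonempty n : exists xy, fac (c n) xy.1 = fac (c n) xy.2 /\ ~ E xy.
  apply: contrapT => no; apply: noE; exists n => i ni x y xy.
  apply: contrapT => nE; apply: no; exists (x, y); split => //=.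
  exact: fiber_mono ni xy.
pose K n := [set xy | fac (c n) xy.1 = fac (c n) xy.2] `&` ~` E.
have [||||[x y] Kxy] := @compact_nested _ K.
- by rewrite -setXTT; apply: compact_setX; exact: detSys_compact.
- move=> n; apply: closedI; last exact: open_closedC.
  have [cf _ _] := fac_factor (c n).
  (* The kernel is closed: any neighbourhoods of the two images contain the common image of a kernel
     pair near [(x, y)], so the images agree by Hausdorffness. *)
  move=> [x y] clxy /=; apply: (@detSys_hausdorff (A n)) => U V Ux Vy.
  have [|[a b] [/= ab [Ua Vb]]] := clxy
    (fst @^-1` (fac (c n) @^-1` U) `&` snd @^-1` (fac (c n) @^-1` V)).
    exists (fac (c n) @^-1` U, fac (c n) @^-1` V) => [|[]//].
    by split; [exact: cf | exact: cf].
  by exists (fac (c n) a); split => //; rewrite ab.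
- by move=> n; have [xy ?] := nonempty n; exists xy.
- move=> n xy [/= h nE]; split => //=; exact: fiber_mono (leqnSn n) h.
have xy : x = y by apply: sc => i; case: (Kxy i).
by have [_] := Kxy 0; rewrite xy; apply; exact: diagE.
Qed.

(** The points of [C] over [a n] form a decreasing sequence of nonempty closed sets. Taking [C]
    arbitrary serves continuity of mediating maps, taking it full serves their existence. *)
Lemma thread_lift (C : set (Defs.space L)) (a : forall i, Defs.space (A i)) :
    closed C -> (forall i, fac (chain_map A i) (a i.+1) = a i) ->
    (forall i, exists2 x, C x & fac (c i) x = a i) ->
  exists2 x, C x & forall i, fac (c i) x = a i.
Proof.
move=> clC athread aC.
have [||||x Kx] := @compact_nested _ (fun n => C `&` fac (c n) @^-1` [set a n]).
- exact: detSys_compact.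
- move=> n; apply: closedI => //; apply: closed_fiber.
  by have [] := fac_factor (c n).
- by move=> n; have [x ? ?] := aC n; exists x.
- by move=> n x [Cx /= xa]; split => //=; rewrite -cocone_fac xa.
by exists x => [|i]; [case: (Kx 0)|case: (Kx i)].
Qed.

(** The mediating factor sends [m] to the point of [L] lying over the thread of its images
    [fac (d i) m]: [thread_lift] provides the point, separation makes it unique. *)
Lemma separating_colimit : is_colimit c.
Proof.
split=> // M d cd.
have dthread m i : fac (chain_map A i) (fac (d i.+1) m) = fac (d i) m.
  by rewrite -(cd i).
have csurj i a : exists x, fac (c i) x = a by have [_] := fac_factor (c i).
have hex m : exists x, forall i, fac (c i) x = fac (d i) m.
  have [||x _ h] := @thread_lift setT (fun i => fac (d i) m) closedT.
  - exact: dthread.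
  - by move=> i; have [x] := csurj i (fac (d i) m); exists x.
  by exists x.
pose h m := sval (cid (hex m)).
have hE m i : fac (c i) (h m) = fac (d i) m by rewrite /h; case: cid.
have hF : is_factor h.
  split=> [|x|m].
  (* A preimage of a closed set is an intersection of closed sets read off level by level; lifting
     the thread inside [C] gives the nontrivial inclusion. *)
  - apply/continuous_closedP => C clC.
    have -> : h @^-1` C = \bigcap_i (fac (d i) @^-1` (fac (c i) @` C)).
      apply/seteqP; split=> [m Cm i _|m dm]; first by exists (h m).
      have [||x Cx xm] := @thread_lift C (fun i => fac (d i) m) clC.
      - exact: dthread.
      - by move=> i; have [x] := dm i I; exists x.
      by rewrite /preimage /=; have -> : h m = x by apply: sc => i; rewrite hE xm.
    apply: closed_bigI => i _; have [cdi _ _] := fac_factor (d i).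
    apply: closed_comp (fun _ _ => cdi _) _.
    have [cci _ _] := fac_factor (c i).
    by apply: closed_image => //; [exact: detSys_compact|exact: detSys_hausdorff].
  (* Surjectivity uses compactness of [M]: the fibres over the images of [x] are nested. *)
  - have cM n : closed (fac (d n) @^-1` [set fac (c n) x]).
      by apply: closed_fiber; have [] := fac_factor (d n).
    have [||m dm] := compact_nested (@detSys_compact M) cM.
    + by move=> n; have [_ sd _] := fac_factor (d n); have [m] := sd (fac (c n) x); exists m.
    + by move=> n m /= dm; rewrite -cocone_fac -dthread dm.
    by exists m; apply: sc => i; rewrite hE dm.
  - apply: sc => i; have [_ _ edi] := fac_factor (d i).
    by have [_ _ eci] := fac_factor (c i); rewrite hE edi eci hE.
exists (EFPair hF erefl : mor L M); split=> [i|k kd].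
  by apply: efpair_eq; apply/funext => m; exact: hE.
by apply: efpair_eq; apply/funext => m; apply: sc => i; rewrite /= hE -(kd i).
Qed.

End Cone.

(** * Inverse limits *)

Section SeparatingSequence.
Variables (T : topologicalType) (K : nat -> set T).
Hypothesis cT : compact [set: T].
Hypothesis clK : forall n, clopen (K n).
Hypothesis sepK : forall x y, (forall n, K n x <-> K n y) -> x = y.

(** Prefixes of the map to Cantor space that records membership in the sets [K i]. It is injective
    by [sepK], and by compactness its cylinders form a basis. *)
Definition itinerary (x : T) (n : nat) : seq bool := mkseq (fun i => `[< K i x >]) n.

Definition itinerary_cyl (s : seq bool) : set T := [set x | itinerary x (size s) = s].

Lemma itinerary_cylE x y n :
  itinerary_cyl (itinerary x n) y = (itinerary y n = itinerary x n).
Proof. by rewrite /itinerary_cyl /= size_mkseq. Qed.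

Lemma near_itinerary x n : \forall y \near x, itinerary y n = itinerary x n.
Proof.
elim: n => [|n IH]; first by apply: filterS filterT.
have Hn : \forall y \near x, K n y <-> K n x.
  have [oK cK] := clK n.
  have [Kx|nKx] := pselect (K n x).
    by apply: filterS (open_nbhs_nbhs (conj oK Kx)) => y.
  have oCK : open (~` K n) by exact: closed_openC.
  by apply: filterS (open_nbhs_nbhs (conj oCK nKx)) => y.
near=> y; rewrite /itinerary /mkseq -addn1 iotaD !map_cat /=; congr (_ ++ [:: _]).
  by near: y.
by apply: asbool_equiv_eq; near: y.
Unshelve. all: by end_near. Qed.

Lemma itinerary_cyl_clopen s : clopen (itinerary_cyl s).
Proof.
split.
  rewrite openE => x xs; rewrite /interior /=.
  by apply: filterS (near_itinerary x (size s)) => y yx; exact: etrans yx xs.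
rewrite -[itinerary_cyl s]setCK closedC openE => x xs; rewrite /interior /=.
by apply: filterS (near_itinerary x (size s)) => y yx ys; apply: xs;
  exact: etrans (esym yx) ys.
Qed.

Lemma itinerary_take x m n : m <= n -> take m (itinerary x n) = itinerary x m.
Proof. by move=> mn; rewrite /itinerary /mkseq -map_take take_iota (minn_idPl mn). Qed.

Lemma itinerary_inj x y : (forall n, itinerary x n = itinerary y n) -> x = y.
Proof.
move=> xy; apply: sepK => n.
have := congr1 (fun s => nth false s n) (xy n.+1).
by rewrite !nth_mkseq // => /(congr1 is_true); rewrite !asboolE => ->.
Qed.

(** If no cylinder around [x] fits into the open set [W], the cylinders minus [W] are nested, closed
    and nonempty. A common point has the itinerary of [x], hence is [x], which lies in [W]. *)
Lemma itinerary_basis : basis (range itinerary_cyl).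
Proof.
split; first by move=> _ [s _ <-]; have [] := itinerary_cyl_clopen s.
move=> x V /=; rewrite nbhsE => -[W [oW Wx] WV].
apply: contrapT => noU.
have [|||y Ky] := @compact_nested _ (fun n => itinerary_cyl (itinerary x n) `&` ~` W) cT.
- move=> n; apply: closedI; last exact: open_closedC.
  by have [] := itinerary_cyl_clopen (itinerary x n).
- move=> n; apply: contrapT => Kn; apply: noU.
  exists (itinerary_cyl (itinerary x n)) => [|y yx].
    by split; [exists (itinerary x n)|rewrite itinerary_cylE].
  by apply: WV; apply: contrapT => nWy; apply: Kn; exists y.
- move=> n y [/= + ?]; rewrite !itinerary_cylE => yx; split => //.
  by rewrite -(itinerary_take y (leqnSn n)) yx itinerary_take.
have yx : y = x.
  by apply: itinerary_inj => n; have [] := Ky n; rewrite itinerary_cylE.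
by have [_] := Ky 0; rewrite yx.
Qed.

Lemma separating_clopen_basis : clopen_basis T.
Proof.
exists (range itinerary_cyl); first exact: itinerary_basis.
by move=> _ [s _ <-]; exact: itinerary_cyl_clopen.
Qed.

Lemma separating_second_countable : @second_countable T.
Proof.
exists (range itinerary_cyl); last exact: itinerary_basis.
by apply: sub_countable (card_image_le _ _) _; exact: countableP.
Qed.

Lemma separating_hausdorff : hausdorff_space T.
Proof.
move=> x y clxy; apply: itinerary_inj => n.
by have [z [/= <- <-]] := clxy _ _ (near_itinerary x n) (near_itinerary y n).
Qed.

End SeparatingSequence.

Section InverseLimit.
Variable A : chain detSysEf.

Local Notation prodA := (prod_topology (fun i => Defs.space (A i))).

Definition threads : set prodA :=
  [set x | forall i, fac (chain_map A i) (x i.+1) = x i].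

Local Notation P := (set_type threads).

Definition thread_proj i (x : P) : Defs.space (A i) := (val x : prodA) i.

Lemma thread_proj_step i (x : P) :
  fac (chain_map A i) (thread_proj i.+1 x) = thread_proj i x.
Proof. exact: (set_valP x). Qed.

Lemma thread_proj_continuous i : continuous (@thread_proj i).
Proof.
move=> x; apply: (@continuous_comp _ _ _ _ (fun y : prodA => y i)).
  exact: (@initial_continuous P prodA set_val).
exact: (@proj_continuous _ (fun i => Defs.space (A i)) i).
Qed.

Lemma threads_closed : closed threads.
Proof.
have -> : threads = \bigcap_i [set x : prodA | fac (chain_map A i) (x i.+1) = x i].
  by apply/seteqP; split=> [x Tx i _|x Tx i]; exact: Tx.
apply: closed_bigI => i _ x clx /=.
have px j := @proj_continuous _ (fun i => Defs.space (A i)) j x.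
have [cf _ _] := fac_factor (chain_map A i).
apply: (@detSys_hausdorff (A i)) => U V Ux Vx.
have [|y [/= yi [Uy Vy]]] := clx
  (proj i.+1 @^-1` (fac (chain_map A i) @^-1` U) `&` proj i @^-1` V).
  by apply: filterI; [apply: px; exact: cf | exact: px].
by exists (y i); split => //; rewrite -yi.
Qed.

Lemma threads_compact : compact [set: P].
Proof.
have cprod : compact [set: prodA].
  have := @tychonoff _ (fun i => Defs.space (A i)) (fun=> setT).
  have -> : [set f : forall i, Defs.space (A i) | forall i, setT (f i)] = setT.
    by apply/seteqP; split.
  by apply => i; exact: detSys_compact.
have cX : compact threads by apply: subclosed_compact threads_closed cprod _.
move=> F PF _.
have [|p [Xp clp]] := cX ((fun x : P => val x : prodA) @ F) _.
  by apply: nearW => x; exact: set_valP.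
pose x : P := exist (fun y => y \in threads) p (mem_set Xp).
exists x; split => // U V FU; rewrite nbhsE => -[_ [[W oW <-] Wx] WV].
have FW : F ((fun x : P => val x : prodA) @^-1` (set_val @` U)).
  by apply: filterS FU => y Uy; exists y.
have [_ [[y Uy <-] Wy]] := clp _ _ FW (open_nbhs_nbhs (conj oW Wx)).
by exists y; split => //; exact: WV.
Qed.

(** Pulling back separating clopen sets from all levels lets the preceding section yield
    zero-dimensionality, second countability and Hausdorffness of the limit at once. *)
Lemma threads_separating :
  exists2 K : nat -> set P, forall n, clopen (K n) &
    forall x y, (forall n, K n x <-> K n y) -> x = y.
Proof.
pose K i := sval (cid2 (separating_clopens (A i))).
have clK i : forall k, clopen (K i k) by rewrite /K; case: cid2.
have sepK i : forall x y, (forall k, K i k x <-> K i k y) -> x = y.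
  by rewrite /K; case: cid2.
exists (fun n => if unpickle n is Some (i, k) then @thread_proj i @^-1` K i k else set0).
  move=> n; case: unpickle => [[i k]|]; last exact: clopen0.
  by apply: preimage_clopen; [exact: clK|exact: thread_proj_continuous].
move=> x y xy; apply/val_inj/functional_extensionality_dep => i; apply: sepK => k.
by have := xy (pickle (i, k)); rewrite pickleK.
Qed.

Lemma thread_dyn_subproof (x : P) :
  ((fun i => dyn (thread_proj i x)) : prodA) \in threads.
Proof.
apply/mem_set => i; have [_ _ e] := fac_factor (chain_map A i).
by rewrite e thread_proj_step.
Qed.

Definition thread_dyn (x : P) : P :=
  exist (fun y => y \in threads) _ (thread_dyn_subproof x).

Lemma thread_cvgP (F : set_system P) (x : P) {FF : Filter F} :
  (forall i, @thread_proj i @ F --> thread_proj i x) -> F --> x.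
Proof.
move=> Fx U /=; rewrite nbhsE => -[_ [[V oV <-] Vx] /filterS]; apply.
suff : (fun y : P => val y : prodA) @ F --> (val x : prodA).
  by apply; exact: open_nbhs_nbhs.
apply/cvg_sup => i W.
have /= -> := @nbhsE (initial_topology (fun f : prodA => f i)) (val x).
move=> [_ [[B oB <-] Bx] BW].
have FB : F (@thread_proj i @^-1` B) by apply: Fx; exact: open_nbhs_nbhs.
by apply: filterS FB => y By; apply: BW; rewrite /preimage /=; exact: By.
Qed.

Lemma thread_dyn_continuous : continuous thread_dyn.
Proof.
move=> x; apply: (@thread_cvgP _ _ (fmap_filter thread_dyn (nbhs_filter x))) => i.
apply: (@continuous_comp _ _ _ (@thread_proj i) (@dyn (A i))).
  exact: thread_proj_continuous.
exact: dyn_continuous.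
Qed.

End InverseLimit.

(** For level 0, preimages are chosen successively along the chain. For a higher level, the chain is
    shifted by one and the missing zeroth term is filled in by the chain map. *)
Lemma thread_proj_surjective (A : chain detSysEf) i (a : Defs.space (A i)) :
  exists x, thread_proj i x = a :> Defs.space (A i).
Proof.
suff [x xthread xa] : exists2 x : forall j, Defs.space (A j),
    (forall j, fac (chain_map A j) (x j.+1) = x j) & x i = a.
  by exists (exist (fun y => y \in @threads A) _ (mem_set xthread)).
elim: i => [|i IH] in A a *.
  have s j (b : Defs.space (A j)) : exists b', fac (chain_map A j) b' = b.
    by have [_] := fac_factor (chain_map A j).
  pose x := nat_rect (fun j => Defs.space (A j)) a (fun j b => sval (cid (s j b))).
  by exists x => // j; rewrite /x /=; case: cid.
have [x xt xa] := IH (@Chain detSysEf (fun j => A j.+1) (fun j => chain_map A j.+1)) a.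
exists (fun j => if j is k.+1 then x k else fac (chain_map A 0) (x 0)) => //.
by case.
Qed.

Lemma inverse_limit (A : chain detSysEf) :
  exists (L : detSysEf) (c : forall i, mor (A i) L), is_cocone c /\ separating c.
Proof.
have [K clK sepK] := threads_separating A.
have [a0 _] := detSys_nonempty (A 0).
have [x0 _] := thread_proj_surjective a0.
pose L : detSys := DetSys (separating_clopen_basis (@threads_compact A) clK sepK)
  (separating_second_countable (@threads_compact A) clK sepK) (@threads_compact A)
  (separating_hausdorff clK sepK) (@thread_dyn_continuous A)
  (ex_intro _ x0 I).
have F i : is_factor (thread_proj i : L -> A i).
  by split; [exact: thread_proj_continuous|exact: thread_proj_surjective|].
exists L, (fun i => EFPair (F i) erefl); split=> [i|x y xy].
  by apply: efpair_eq; apply/funext => x; exact: thread_proj_step.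
by apply: val_inj; apply/functional_extensionality_dep; exact: xy.
Qed.

(** * Colimits of chains of shifts *)

Lemma hausdorff_prod (X Y : topologicalType) :
  hausdorff_space X -> hausdorff_space Y -> hausdorff_space (X * Y)%type.
Proof.
move=> hX hY [a b] [c d] cl; congr pair.
  apply: hX => U V Ua Vc.
  have [||[x y] [/= ? ?]] := cl (fst @^-1` U) (fst @^-1` V); last by exists x.
    by exists (U, setT) => [|[? ?] []//]; split => //; exact: filterT.
  by exists (V, setT) => [|[? ?] []//]; split => //; exact: filterT.
apply: hY => U V Ub Vd.
have [||[x y] [/= ? ?]] := cl (snd @^-1` U) (snd @^-1` V); last by exists y.
  by exists (setT, U) => [|[? ?] []//]; split => //; exact: filterT.
by exists (setT, V) => [|[? ?] []//]; split => //; exact: filterT.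
Qed.

Lemma open_pairs (T : topologicalType) (E : set (T * T)) (R : T -> T -> Prop) :
    (forall x, \forall y \near x, R x y) ->
    (forall x y x' y', E (x, y) -> R x x' -> R y y' -> E (x', y')) ->
  open E.
Proof.
move=> nR RE; rewrite openE => -[x y] Exy.
exists ([set z | R x z], [set z | R y z]); first by split; exact: nR.
by move=> [x' y'] [/= xx' yy']; exact: RE Exy xx' yy'.
Qed.

Lemma iter_dyn_factor (Y X : detSys) (f : Y -> X) n y :
  is_factor f -> f (iter n (@dyn Y) y) = iter n (@dyn X) (f y).
Proof. by move=> [_ _ ef]; elim: n => //= n <-; rewrite ef. Qed.

Lemma iter_shift_dyn (X : shift_space) (x : shift_sys X) n i :
  val (iter n (@dyn (shift_sys X)) x) i = val x (n + i).
Proof. by elim: n i => [//|n IH] i; rewrite /= [LHS]IH addnS. Qed.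

(** A point of a shift is determined by the zeroth letters of its orbit. *)
Lemma shift_kernel (L : detSys) (X : shift_space) (g : L -> shift_sys X) :
    is_factor g ->
  exists E : set (L * L), [/\ open E, forall x, E (x, x) &
    forall (Z : detSys) (f : L -> Z), is_factor f ->
      (forall x y, f x = f y -> E (x, y)) -> forall x y, f x = f y -> g x = g y].
Proof.
move=> Fg; pose E := [set xy : L * L | val (g xy.1) 0 = val (g xy.2) 0].
exists E; split=> [//|//|Z f Ff fE x y fxy].
  apply: (@open_pairs _ _ (fun x y => val (g y) 0 = val (g x) 0)) => [x|].
    have [cg _ _] := Fg.
    have : \forall z \near g x, val z 0 = val (g x) 0.
      have := @discrete_set1 (discrete_topology (alphabet X)) (val (g x) 0).
      exact: (@Defs.coord_continuous X 0 (g x)).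
    exact: (cg x).
  by rewrite /E /= => x y x' y' xy -> ->.
apply: val_inj; apply/funext => i.
(* Since [f] commutes with the dynamics, the [i]-th iterates also have equal images, so their zeroth
   letters, which are the [i]-th letters, agree. *)
have := fE (iter i (@dyn L) x) (iter i (@dyn L) y).
rewrite !iter_dyn_factor // fxy => /(_ erefl); rewrite /E /= !iter_dyn_factor //.
by rewrite !iter_shift_dyn addn0.
Qed.

(** [fac h'] is injective with left inverse [fac h], and each [fac (c i)] factors through it, so
    separation passes from [L'] to [L]. *)
Lemma separating_through (A : chain detSysEf) (L L' : detSysEf)
    (c : forall i, mor (A i) L) (c' : forall i, mor (A i) L')
    (h : mor L L') (h' : mor L' L) :
  compm h' h = idm L -> (forall i, compm h' (c' i) = c i) -> separating c' ->
  separating c.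
Proof.
move=> hh hc sc x y xy.
have hK z : fac h (fac h' z) = z by have := congr1 (fun p => fac p z) hh.
by rewrite -(hK x) -(hK y); congr fac; apply: sc => i; have := xy i; rewrite -hc.
Qed.

(** The colimit is compared with the concrete inverse limit, which separates points; uniqueness of
    mediating morphisms makes their composite the identity of [L]. *)
Lemma colimit_separating (A : chain detSysEf) (L : detSysEf)
    (c : forall i, mor (A i) L) :
  is_colimit c -> separating c.
Proof.
move=> [cc uc]; have [L' [c' [cc' sc']]] := inverse_limit A.
have [h [hc _]] := uc _ _ cc'.
have [h' [h'c _]] := (separating_colimit cc' sc').2 _ _ cc.
apply: (@separating_through _ _ _ c c' h h') => //.
have [k [_ kuniq]] := uc _ _ cc.
rewrite -(kuniq (compm h' h)) ?(kuniq (idm L)) // => i; first exact: comp1m.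
by rewrite -compmA hc h'c.
Qed.

(** * Approximation of systems by shifts in [S] *)

Section DS.
Variable S : shift_space -> Prop.

(** This condition characterizes the objects of [DSef S]; unlike the definition
    through chains it is easily seen to pass to inverse limits. *)
Definition approximated (L : detSys) : Prop :=
  forall E : set (L * L), open E -> (forall x, E (x, x)) ->
  exists2 X, S X & exists2 f : L -> shift_sys X, is_factor f &
    forall x y, f x = f y -> E (x, y).

Lemma chain_colimit_approximated (L : detSysEf) :
  chain_colimit_of_shifts S L -> approximated L.
Proof.
move=> [A [c [AS colc]]] E oE dE.
have [n /(_ n (leqnn n)) nE] := separating_fine colc.1 (colimit_separating colc) oE dE.
have [X SX AX] := AS n; exists X => //.
move: (A n) (c n) AX nE => B f AX; subst B => fE.
by exists (fac f) => //; exact: fac_factor.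
Qed.

Record shift_quotient (L : detSysEf) := ShiftQuotient {
  quotient_shift : shift_space;
  quotient_in : S quotient_shift;
  quotient_mor : mor (shift_sys quotient_shift : detSysEf) L
}.

(** Step [n] picks a shift quotient whose kernel respects the separating clopen set [K n] and
    refines the previous kernel. Decreasing kernels induce the chain maps, and the whole sequence
    separates points. *)
Lemma approximated_chain_colimit (L : detSysEf) :
  approximated L -> chain_colimit_of_shifts S L.
Proof.
move=> apL; have [K clK sepK] := separating_clopens L.
have refine (E : set (L * L)) (p : shift_quotient L) : open E -> (forall x, E (x, x)) ->
  exists q : shift_quotient L, forall x y,
    fac (quotient_mor q) x = fac (quotient_mor q) y ->
    E (x, y) /\ fac (quotient_mor p) x = fac (quotient_mor p) y.
  move=> oE dE; have [E' [oE' dE' E'p]] := shift_kernel (fac_factor (quotient_mor p)).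
  have [||X SX [f Ff fE]] := apL (E `&` E'); [exact: openI|by []|].
  exists (ShiftQuotient SX (EFPair Ff erefl : mor (shift_sys X : detSysEf) L)).
  move=> x y /= fxy; split; first by case: (fE _ _ fxy).
  by apply: (E'p _ f) => // x' y' /fE [].
pose E n := [set xy : L * L | K n xy.1 <-> K n xy.2].
have oE n : open (E n).
  apply: (@open_pairs _ _ (fun x y => K n x <-> K n y)) => [x|].
    have [oK cK] := clK n.
    have [Kx|nKx] := pselect (K n x).
      by apply: filterS (open_nbhs_nbhs (conj oK Kx)) => y.
    have oCK : open (~` K n) by exact: closed_openC.
    by apply: filterS (open_nbhs_nbhs (conj oCK nKx)) => y.
  by move=> x y x' y'; rewrite /E /= => -> -> ->.
have dE n x : E n (x, x) by [].
have [||X0 SX0 [f0 Ff0 _]] := apL setT; [exact: openT|by []|].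
pose q0 := ShiftQuotient SX0 (EFPair Ff0 erefl : mor (shift_sys X0 : detSysEf) L).
pose step n p := sval (cid (refine (E n) p (oE n) (dE n))).
pose q := nat_rect (fun=> shift_quotient L) q0 step.
have qE n x y : fac (quotient_mor (q n.+1)) x = fac (quotient_mor (q n.+1)) y ->
    E n (x, y) /\ fac (quotient_mor (q n)) x = fac (quotient_mor (q n)) y.
  by rewrite [q n.+1]/(step n (q n)) /step; case: cid => /= r; apply.
pose A n : detSysEf := shift_sys (quotient_shift (q n)).
have mapP n : exists m : mor (A n) (A n.+1),
    compm (quotient_mor (q n.+1)) m = quotient_mor (q n).
  have [|h Fh hE] := factor_lift (fac_factor (quotient_mor (q n.+1)))
      (fac_factor (quotient_mor (q n))).
    by move=> x y /qE[].
  by exists (EFPair Fh erefl); apply: efpair_eq; rewrite hE.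
pose Ac := @Chain detSysEf A (fun n => sval (cid (mapP n))).
exists Ac, (fun n => quotient_mor (q n)); split.
  by move=> n; exists (quotient_shift (q n)) => //; exact: quotient_in.
apply: separating_colimit => [n|x y xy]; first by rewrite /=; case: cid.
by apply: sepK => n; have [] := qE n _ _ (xy n.+1).
Qed.

(** [E] contains the kernel of some level map [f]. The pairs whose full preimage lies in [E] then
    form an open neighbourhood of the diagonal of that level; an approximation there is composed
    with [f]. *)
Lemma approximated_limit (A : chain detSysEf) (L : detSysEf)
    (c : forall i, mor (A i) L) :
  is_cocone c -> separating c -> (forall i, approximated (A i)) -> approximated L.
Proof.
move=> cc sc apA E oE dE.
have [n /(_ n (leqnn n)) nE] := separating_fine cc sc oE dE.
have Ff := fac_factor (c n); set f := fac (c n) in nE Ff.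
pose f2 (xy : L * L) := (f xy.1, f xy.2).
have [||X SX [g Fg gE]] := apA n (~` (f2 @` ~` E)).
- apply: closed_openC; apply: closed_image; last exact: open_closedC.
  + by rewrite -setXTT; apply: compact_setX; exact: detSys_compact.
  + by apply: hausdorff_prod; exact: detSys_hausdorff.
  + have [cf _ _] := Ff; move=> [x y]; apply: cvg_pair.
      by apply: continuous_comp; [exact: cvg_fst|exact: cf].
    by apply: continuous_comp; [exact: cvg_snd|exact: cf].
- by move=> x [[y z] /= nEyz [yx zx]]; apply: nEyz; apply: nE; rewrite yx zx.
exists X => //; exists (g \o f); first exact: is_factor_comp.
move=> x y /gE /= fxy; apply: contrapT => nExy; apply: fxy.
by exists (x, y).
Qed.

Definition sub_chain (A : chain (DSef S)) : chain detSysEf :=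
  @Chain detSysEf (fun i => sval (A i)) (fun i => chain_map A i).

Lemma DSef_chain_limit (A : chain (DSef S)) :
  exists (L : DSef S) (c : forall i, mor (A i) L),
    is_cocone (A := sub_chain A) c /\ separating (A := sub_chain A) c.
Proof.
have [L [c [cc sc]]] := inverse_limit (sub_chain A).
have SL : chain_colimit_of_shifts S L.
  apply: approximated_chain_colimit; apply: approximated_limit cc sc _ => i.
  exact: chain_colimit_approximated (svalP (A i)).
by exists (exist _ L SL), c.
Qed.

Lemma DSef_separating_colimit (A : chain (DSef S)) (L : DSef S)
    (c : forall i, mor (A i) L) :
  is_cocone (A := sub_chain A) c -> separating (A := sub_chain A) c -> is_colimit c.
Proof.
move=> cc sc; have [_ uc] := separating_colimit cc sc.
by split => // M d cd; exact: (uc (sval M) d cd).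
Qed.

(** A colimit in the subcategory is tested only on cocones inside it, so the comparison needs an
    inverse limit that is itself an object of [DSef S]. *)
Lemma DSef_colimit_separating (A : chain (DSef S)) (L : DSef S)
    (c : forall i, mor (A i) L) :
  is_colimit c -> separating (A := sub_chain A) c.
Proof.
move=> [cc uc]; have [L' [c' [cc' sc']]] := DSef_chain_limit A.
have [h [hc _]] := uc L' c' cc'.
have [h' [h'c _]] := (DSef_separating_colimit cc' sc').2 L c cc.
apply: (@separating_through (sub_chain A) _ _ c c' h h') => //.
have [k [_ kuniq]] := uc L c cc.
have e1 := kuniq (compm (h' : mor L' L) h).
have e2 := kuniq (idm L).
rewrite -[LHS]e1 ?e2 // => i; first exact: (comp1m (c i : mor (A i) L)).
have := compmA (h' : mor L' L) h (c i); rewrite hc h'c; exact: esym.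
Qed.

End DS.

(** * Universal homogeneous objects *)

Section CategoryFacts.
Variable C : category.

Lemma is_iso_comp (X Y Z : C) (g : mor Y Z) (f : mor X Y) :
  is_iso g -> is_iso f -> is_iso (compm g f).
Proof.
move=> [g' [g'g gg']] [f' [f'f ff']]; exists (compm f' g'); split.
  by rewrite -compmA (compmA g') g'g comp1m.
by rewrite -compmA (compmA f) ff' comp1m.
Qed.

Lemma is_iso_inv (X Y : C) (f : mor X Y) :
  is_iso f -> exists2 g : mor Y X, compm g f = idm X /\ compm f g = idm Y & is_iso g.
Proof. by move=> [g [gf fg]]; exists g => //; exists f. Qed.

Lemma finite_object_iso (X Y : C) :
  isomorphic X Y -> finite_object Y -> finite_object X.
Proof.
move=> [f [f' [f'f ff']]] finY A L c colc g.
have [n nP] := finY A L c colc (compm g f').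
exists n => i ni; have [h [hE huniq]] := nP i ni.
exists (compm h f); split; first by rewrite compmA -hE -compmA f'f compm1.
move=> k kE; rewrite (huniq (compm k f')) ?compmA -?kE //.
by rewrite -compmA f'f compm1.
Qed.

Lemma countable_mor_iso (X Y Z : C) :
  isomorphic X Y -> countable [set: mor Y Z] -> countable [set: mor X Z].
Proof.
move=> [f [f' [f'f ff']]] /countable_injP[k kI].
apply/countable_injP; exists (fun g => k (compm g f')) => g h _ _.
move=> /(kI _ _ (in_setT _) (in_setT _)) /(congr1 (fun u => compm u f)).
by rewrite -!compmA f'f !compm1.
Qed.

End CategoryFacts.

(** * Fraisse theorem for an abstract class of finite objects *)

Section Fraisse.
Variables (C : category) (F : C -> Prop).
Hypothesis monoC : forall (X Y : C) (f : mor X Y), is_monic f.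
Hypothesis finF : forall X, F X -> finite_object X.
Hypothesis colimF : forall L : C, exists (A : chain C) (c : forall i, mor (A i) L),
  (forall i, F (A i)) /\ is_colimit c.
Hypothesis chainF : forall A : chain C, (forall i, F (A i)) ->
  exists (L : C) (c : forall i, mor (A i) L), is_colimit c.
Hypothesis countF : countable_class F.
Hypothesis countM : forall X Y : C, F X -> F Y -> countable [set: mor X Y].

Definition joint_embedding : Prop :=
  forall X0 X1 : C, F X0 -> F X1 ->
  exists2 Y, F Y & inhabited (mor X0 Y) /\ inhabited (mor X1 Y).

Definition amalgamation : Prop :=
  forall (X Y0 Y1 : C) (f0 : mor X Y0) (f1 : mor X Y1), F X -> F Y0 -> F Y1 ->
  exists2 Z, F Z & exists (g0 : mor Y0 Z) (g1 : mor Y1 Z), compm g0 f0 = compm g1 f1.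

(** The richness property that the chain construction aims at; homogeneity follows from it, and
    universality follows once joint embedding is added. *)
Definition extension_property (U : C) : Prop :=
  forall (X Y : C) (g : mor X Y) (f : mor X U), F X -> F Y ->
  exists h : mor Y U, compm h g = f.

(** Both morphisms factor through a common stage of a chain of finite objects with colimit [L]. *)
Lemma finite_cofactor (L X0 X1 : C) (f0 : mor X0 L) (f1 : mor X1 L) :
  F X0 -> F X1 -> exists2 Y, F Y & exists (h : mor Y L) (g0 : mor X0 Y) (g1 : mor X1 Y),
    compm h g0 = f0 /\ compm h g1 = f1.
Proof.
move=> FX0 FX1; have [A [c [FA colc]]] := colimF L.
have [n0 /(_ _ (leq_maxl n0 _)) n0P] := finF FX0 colc f0.
have [n1 /(_ _ (leq_maxr _ n1)) n1P] := finF FX1 colc f1.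
have [g0 [g0E _]] := n0P n1; have [g1 [g1E _]] := n1P n0.
by exists (A (maxn n0 n1)) => //; exists (c (maxn n0 n1)), g0, g1.
Qed.

(** Since [p] is monic, the lifts form a cocone; its mediating morphism is a right inverse of [p],
    and two-sided again by monicity. *)
Lemma colimit_mono_iso (A : chain C) (U V : C) (c : forall i, mor (A i) U)
    (p : mor V U) :
  is_colimit c -> (forall i, exists s : mor (A i) V, compm p s = c i) -> is_iso p.
Proof.
move=> [cc uc] ps; pose s i := sval (cid (ps i)).
have sE i : compm p (s i) = c i by rewrite /s; case: cid.
have cs : is_cocone s by move=> i; apply: (monoC (f := p)); rewrite compmA !sE.
have [r [rE _]] := uc _ _ cs.
have pr : compm p r = idm U.
  have [k [_ kuniq]] := uc _ _ cc.
  rewrite -(kuniq (compm p r)) ?(kuniq (idm U)) // => i; first exact: comp1m.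
  by rewrite -compmA rE sE.
by exists r; split => //; apply: (monoC (f := p)); rewrite compmA pr comp1m compm1.
Qed.

Section Necessity.
Variable U : C.
Hypothesis univU : universal (fun=> True) U.
Hypothesis homU : homogeneous F U.

Lemma universal_joint_embedding : joint_embedding.
Proof.
move=> X0 X1 FX0 FX1; have [f0] := univU (A := X0) I; have [f1] := univU (A := X1) I.
by have [Y FY [h [g0 [g1 _]]]] := finite_cofactor f0 f1 FX0 FX1; exists Y.
Qed.

(** Inside [U], an automorphism makes the two composites out of [X] agree. A finite object through
    which both embeddings factor is the amalgam, as its monic morphism to [U] cancels. *)
Lemma homogeneous_amalgamation : amalgamation.
Proof.
move=> X Y0 Y1 f0 f1 FX FY0 FY1.
have [u0] := univU (A := Y0) I; have [u1] := univU (A := Y1) I.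
have [h [_ hE]] := homU FX (compm u0 f0) (compm u1 f1).
have [Z FZ [k [g0 [g1 [g0E g1E]]]]] := finite_cofactor u0 (compm h u1) FY0 FY1.
exists Z => //; exists g0, g1; apply: (monoC (f := k)).
by rewrite !compmA g0E g1E -hE compmA.
Qed.

End Necessity.

Section Sufficiency.

Lemma extension_universal (U : C) :
  joint_embedding -> extension_property U -> universal (fun=> True) U.
Proof.
move=> JEP EP L _; have [A [c [FA [cc uc]]]] := colimF L.
have [B [b [FB _]]] := colimF U.
(* A first morphism from [A 0] to [U]: join [A 0] with some [B 0] that already maps to [U], and
   extend that map to [Y]. The rest of the chain is then extended step by step. *)
have [Y FY [[y0] [y1]]] := JEP _ _ (FA 0) (FB 0).
have [h _] := EP _ _ y1 (b 0) (FB 0) FY.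
have step i (u : mor (A i) U) : exists v : mor (A i.+1) U, compm v (chain_map A i) = u.
  exact: EP.
pose u := nat_rect (fun i => mor (A i) U) (compm h y0) (fun i u => sval (cid (step i u))).
have cu : is_cocone u by move=> i; rewrite /u /=; case: cid.
by have [k _] := uc _ _ cu; exists.
Qed.

Record span (U : C) := Span {
  apex : C;
  apexF : F apex;
  lleg : mor apex U;
  rleg : mor apex U
}.

(** Back and forth: the two given morphisms are extended alternately along one
    chain [W] until both exhaust [U]; both mediating morphisms from the colimit
    of [W] to [U] are then isomorphisms. *)
Lemma extension_homogeneous (U : C) : extension_property U -> homogeneous F U.
Proof.
move=> EP X FX f g; have [A [c [FA colc]]] := colimF U.
(* [half] makes the first leg reach [c n] and drags the second along by extension; [step] applies it
   twice, with the legs swapped. *)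
have half n (W : C) (p q : mor W U) : F W -> exists2 W', F W' &
    exists (w : mor W W') (p' q' : mor W' U),
    [/\ compm p' w = p, compm q' w = q & exists s : mor (A n) W', compm p' s = c n].
  move=> FW; have [W' FW' [p' [w [s [p'w p's]]]]] := finite_cofactor p (c n) FW (FA n).
  have [q' q'w] := EP _ _ w q FW FW'.
  by exists W' => //; exists w, p', q'; split => //; exists s.
have step n (x : span U) : exists (y : span U) (w : mor (apex x) (apex y)),
    [/\ compm (lleg y) w = lleg x, compm (rleg y) w = rleg x,
      exists s : mor (A n) (apex y), compm (lleg y) s = c n &
      exists s : mor (A n) (apex y), compm (rleg y) s = c n].
  have [W FW [w [p [q [pw qw [s ps]]]]]] := half n _ (lleg x) (rleg x) (apexF x).
  have [W' FW' [w' [q' [p' [qw' pw' [s' qs]]]]]] := half n _ q p FW.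
  exists (Span FW' p' q'), (compm w' w); split => /=.
  - by rewrite compmA pw'.
  - by rewrite compmA qw'.
  - by exists (compm w' s); rewrite compmA pw'.
  - by exists s'.
pose x := nat_rect (fun=> span U) (Span FX f g) (fun n x => sval (cid (step n x))).
have xP n : exists w : mor (apex (x n)) (apex (x n.+1)),
    [/\ compm (lleg (x n.+1)) w = lleg (x n), compm (rleg (x n.+1)) w = rleg (x n),
      exists s : mor (A n) (apex (x n.+1)), compm (lleg (x n.+1)) s = c n &
      exists s : mor (A n) (apex (x n.+1)), compm (rleg (x n.+1)) s = c n].
  exact: svalP (cid (step n (x n))).
pose W := @Chain C (fun n => apex (x n)) (fun n => sval (cid (xP n))).
have cp : is_cocone (A := W) (fun n => lleg (x n)) by move=> n; have [] := svalP (cid (xP n)).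
have cq : is_cocone (A := W) (fun n => rleg (x n)) by move=> n; have [] := svalP (cid (xP n)).
have [V [v [cv uv]]] := chainF (A := W) (fun n => apexF (x n)).
have [p [pv _]] := uv _ _ cp; have [q [qv _]] := uv _ _ cq.
have pI : is_iso p.
  apply: (colimit_mono_iso colc) => n; have [_ [_ _ [s sE] _]] := xP n.
  by exists (compm (v n.+1) s); rewrite compmA (pv n.+1).
have qI : is_iso q.
  apply: (colimit_mono_iso colc) => n; have [_ [_ _ _ [s sE]]] := xP n.
  by exists (compm (v n.+1) s); rewrite compmA (qv n.+1).
have [q' [q'q _] q'I] := is_iso_inv qI.
exists (compm p q'); split; first exact: is_iso_comp.
by rewrite -[g](qv 0) -compmA (compmA q') q'q comp1m (pv 0).
Qed.

Record demand (Z : C) := Demand {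
  demand_base : C;
  demand_target : C;
  demand_baseF : F demand_base;
  demand_targetF : F demand_target;
  demand_leg : mor demand_base Z;
  demand_map : mor demand_base demand_target
}.

Definition push_demand (Z Z' : C) (z : mor Z Z') (d : demand Z) : demand Z' :=
  Demand (demand_baseF d) (demand_targetF d) (compm z (demand_leg d)) (demand_map d).

(** A problem is coded by the codes of its two objects and two morphisms; equality of the object
    codes comes first, so that the morphism codes become comparable. *)
Lemma demand_enumeration (Z : C) : F Z ->
  exists e : nat -> option (demand Z), forall d, exists k, e k = Some d.
Proof.
move=> FZ; have [code codeI] := countF.
have mcodeP (X Y : C) : exists k : mor X Y -> nat, F X -> F Y -> injective k.
  have [FXY|nF] := pselect (F X /\ F Y); last first.
    by exists (fun=> 0) => FX FY; case: nF.
  have /countable_injP[k kI] := countM FXY.1 FXY.2.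
  by exists k => _ _ f g; apply: kI; exact: in_setT.
pose mcode X Y := sval (cid (mcodeP X Y)).
have mcodeI X Y : F X -> F Y -> injective (mcode X Y) by rewrite /mcode; case: cid.
pose dcode (d : demand Z) := pickle (code (demand_base d), code (demand_target d),
  mcode _ _ (demand_leg d), mcode _ _ (demand_map d)).
have dcodeI : injective dcode.
  move=> [X Y FX FY f g] [X' Y' FX' FY' f' g'] /(pcan_inj pickleK) /= [].
  move=> /(codeI _ _ FX FX') XX'; subst X' => /(codeI _ _ FY FY') YY'; subst Y'.
  move=> /(mcodeI _ _ FX FZ) -> /(mcodeI _ _ FX FY) ->.
  by rewrite (Prop_irrelevance FX FX') (Prop_irrelevance FY FY').
exists (fun k => if pselect (exists d, dcode d = k) is left h then Some (sval (cid h))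
  else None) => d.
exists (dcode d); case: pselect => [h|[]]; last by exists d.
by congr Some; apply: dcodeI; case: cid.
Qed.

(** [pending n k] is the [k]-th extension problem posed over the [n]-th object
    of the chain, pushed forward to the current object. *)
Record stage := Stage {
  stage_obj : C;
  stage_objF : F stage_obj;
  pending : nat -> nat -> option (demand stage_obj)
}.

(** Stage [2 ^ n * (2 * k + 1)], which is not earlier than [n], answers the
    [k]-th problem of stage [n]. *)
Definition slot (m : nat) : nat * nat :=
  (logn 2 m, (m %/ 2 ^ logn 2 m)./2).

Lemma slot_late n k : exists2 m, n <= m & slot m = (n, k).
Proof.
exists (2 ^ n * k.*2.+1).
  by apply: leq_trans (ltnW (ltn_expl n (ltnSn 1))) (leq_pmulr _ _).
have log : logn 2 (2 ^ n * k.*2.+1) = n.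
  rewrite lognM ?expn_gt0 // pfactorK // (@logn_coprime 2 k.*2.+1) ?addn0 //.
  by rewrite coprime2n /= odd_double.
by rewrite /slot log mulKn ?expn_gt0 //= uphalf_double.
Qed.

Definition is_step (m : nat) (s s' : stage) (z : mor (stage_obj s) (stage_obj s')) :
    Prop :=
  [/\ forall n k, n <= m -> pending s' n k = omap (push_demand z) (pending s n k),
      forall d, exists k, pending s' m.+1 k = Some d &
      forall d, pending s (slot m).1 (slot m).2 = Some d ->
        exists h : mor (demand_target d) (stage_obj s'),
          compm h (demand_map d) = compm z (demand_leg d)].

Lemma stage_step (m : nat) (s : stage) : amalgamation ->
  exists (s' : stage) (z : mor (stage_obj s) (stage_obj s')), is_step m z.
Proof.
move=> AP.
have [Z FZ [z zP]] : exists2 Z, F Z & exists z : mor (stage_obj s) Z,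
    forall d, pending s (slot m).1 (slot m).2 = Some d ->
    exists h : mor (demand_target d) Z, compm h (demand_map d) = compm z (demand_leg d).
  (* With no problem in the slot, the chain stays at its object. *)
  case: (pending s (slot m).1 (slot m).2) => [d|]; last first.
    by exists (stage_obj s); [exact: stage_objF|exists (idm _)].
  have [Z FZ [h [z hz]]] := AP _ _ _ (demand_map d) (demand_leg d)
    (demand_baseF d) (demand_targetF d) (stage_objF s).
  by exists Z => //; exists z => _ [<-]; exists h.
have [e eP] := demand_enumeration FZ.
exists (Stage FZ (fun n k => if n == m.+1 then e k
  else omap (push_demand z) (pending s n k))), z; split => //= [n k nm|d].
  by rewrite ltn_eqF.
by have [k ek] := eP d; exists k; rewrite eqxx.
Qed.

(** By finiteness a problem over [U] already lives over some stage [n], where it is listed in row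
    [n]. It is pushed forward until the stage whose slot names it, and the answer given there maps
    on to [U]. *)
Lemma extension_exists : (exists X, F X) -> amalgamation ->
  exists U, extension_property U.
Proof.
move=> [Z0 FZ0] AP; have [e0 e0P] := demand_enumeration FZ0.
pose s := nat_rect (fun=> stage) (Stage FZ0 (fun=> e0))
  (fun m s => sval (cid (stage_step m s AP))).
have sP m : exists z : mor (stage_obj (s m)) (stage_obj (s m.+1)), is_step m z.
  exact: svalP (cid (stage_step m (s m) AP)).
pose z m := sval (cid (sP m)).
have zP m : is_step m (z m) by exact: svalP (cid (sP m)).
pose A := @Chain C (fun m => stage_obj (s m)) z.
have FA m : F (A m) by exact: stage_objF.
have [U [c colc]] := chainF FA; have [cc _] := colc.
exists U => X Y g f FX FY.
have [n /(_ n (leqnn n)) [f' [fE _]]] := finF FX colc f.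
have [k kE] : exists k, pending (s n) n k = Some (Demand FX FY f' g).
  case: n f' fE => [|n] f' _; first exact: e0P.
  by have [_ en _] := zP n; exact: en.
(* While waiting, the problem keeps its place in the list and its leg still represents [f]. *)
have inv m : n <= m -> exists2 fm : mor X (A m),
    pending (s m) n k = Some (Demand FX FY fm g) & compm (c m) fm = f.
  elim: m => [|m IH].
    by rewrite leqn0 => /eqP n0; subst n; exists f'.
  rewrite leq_eqVlt => /orP[/eqP nm|]; first by subst n; exists f'.
  rewrite ltnS => nm; have [fm mE <-] := IH nm.
  exists (compm (z m) fm); last by rewrite compmA (cc m).
  by have [-> // _ _] := zP m; rewrite mE.
have [m nm slotm] := slot_late n k; have [fm mE fmE] := inv m nm.
have [_ _ answer] := zP m; rewrite slotm /= in answer; have [h /= hE] := answer _ mE.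
by exists (compm (c m.+1) h); rewrite -compmA hE compmA (cc m).
Qed.

End Sufficiency.

Theorem universal_homogeneous_iff : (exists X, F X) ->
  (exists U, universal (fun=> True) U /\ homogeneous F U) <->
  joint_embedding /\ amalgamation.
Proof.
move=> F0; split=> [[U [univU homU]]|[JEP AP]].
  split; first exact: universal_joint_embedding univU.
  exact: homogeneous_amalgamation univU homU.
have [U EP] := extension_exists F0 AP.
by exists U; split; [exact: extension_universal|exact: extension_homogeneous].
Qed.

End Fraisse.

(** * Shifts as the finite objects *)

Section DSefAlgebroidal.
Variable S : shift_space -> Prop.

Lemma DSef_mono (X Y : DSef S) (f : mor X Y) : is_monic f.
Proof.
move=> W p q pq; apply: efpair_eq; apply/funext => x.
have [_ sf _] := fac_factor f; have [y <-] := sf x.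
exact: (congr1 (fun r : efpair (sval W) (sval Y) => fac r y) pq).
Qed.

(** From some level on, the kernel of [fac (c i)] lies in that of [fac g], so [fac g] factors
    through it; uniqueness holds as [c i] is monic. *)
Lemma shift_objs_finite (E : DSef S) : shift_objs S E -> finite_object E.
Proof.
move=> [X [SX ->]] A L c colc g.
have sc := DSef_colimit_separating colc.
have [E' [oE' dE' E'g]] := shift_kernel (fac_factor g).
have [n nE'] := separating_fine (A := sub_chain A) colc.1 sc oE' dE'.
exists n => i ni.
have [|h Fh hE] := factor_lift (fac_factor (c i)) (fac_factor g).
  exact: E'g (fac_factor (c i)) (nE' i ni).
exists (EFPair Fh erefl); split=> [|k kE]; first exact: efpair_eq.
apply: (@DSef_mono _ _ (c i)); rewrite -kE.
by apply: efpair_eq; rewrite hE.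
Qed.

Lemma shift_objs_transport (L : detSysEf) (SL : chain_colimit_of_shifts S L)
    (X : shift_space) :
  S X -> L = shift_sys X -> shift_objs S (exist _ L SL).
Proof.
move=> SX LX; subst L; exists X, SX.
by rewrite /shift_obj (Prop_irrelevance SL (shift_chain_colimit SX)).
Qed.

Lemma DSef_shift_chain (L : DSef S) :
  exists (A : chain (DSef S)) (c : forall i, mor (A i) L),
    (forall i, shift_objs S (A i)) /\ is_colimit c.
Proof.
have [A [c [AS colc]]] := svalP L.
have SA i : chain_colimit_of_shifts S (A i).
  by have [X SX ->] := AS i; exact: shift_chain_colimit.
pose B := @Chain (DSef S) (fun i => exist _ (A i) (SA i)) (fun i => chain_map A i).
exists B, c; split.
  by move=> i; have [X SX AX] := AS i; exact: shift_objs_transport AX.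
apply: (@DSef_separating_colimit S B L c); first exact: colc.1.
exact: colimit_separating colc.
Qed.

Lemma DSef_chain_colimit (A : chain (DSef S)) :
  exists (L : DSef S) (c : forall i, mor (A i) L), is_colimit c.
Proof.
have [L [c [cc sc]]] := DSef_chain_limit A.
by exists L, c; exact: DSef_separating_colimit.
Qed.

(** The identity of [E] factors through a stage of a chain of shifts; the morphism from that stage
    is a monic split epimorphism, hence invertible. *)
Lemma DSef_finite_shift (E : DSef S) :
  finite_object E -> exists2 X, shift_objs S X & isomorphic E X.
Proof.
move=> finE; have [A [c [AS colc]]] := DSef_shift_chain E.
have [n /(_ n (leqnn n)) [h [hE _]]] := finE A E c colc (idm E).
exists (A n) => //; exists h; exists (c n); split; first exact: esym hE.
by apply: (@DSef_mono _ _ (c n)); rewrite compmA -hE comp1m compm1.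
Qed.

Lemma DSef_finiteP (E : DSef S) :
  finite_object E <-> exists2 X, shift_objs S X & isomorphic E X.
Proof.
split; first exact: DSef_finite_shift.
by move=> [X SX EX]; apply: finite_object_iso EX _; exact: shift_objs_finite.
Qed.

(** A factor onto a shift is determined by the clopen partition according to
    the zeroth letter. *)
Lemma countable_mor_shift (X : shift_space) (L : detSysEf) :
  countable [set: mor (shift_sys X : detSysEf) L].
Proof.
have /countable_injP[code codeI] := countable_clopen L.
pose letter_cyl (f : efpair (shift_sys X) L) a := [set y : L | val (fac f y) 0 = a].
have clC f a : clopen (letter_cyl f a).
  have [cf _ _] := fac_factor f.
  have co : continuous (fun y : L => (val (fac f y) : seqs _) 0
      : discrete_topology (alphabet X)).
    move=> y; exact: cvg_comp (cf y) (@Defs.coord_continuous X 0 (fac f y)).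
  have cla : clopen [set (a : discrete_topology (alphabet X))].
    by split; [exact: discrete_open|exact: discrete_closed].
  exact: preimage_clopen cla co.
apply/countable_injP.
(* The alphabet is finite, so a partition into clopen sets has a finite code. *)
exists (fun f => pickle [ffun a => code (letter_cyl f a)]) => f g _ _.
move=> /(pcan_inj pickleK) /ffunP fg.
have fgC a : letter_cyl f a = letter_cyl g a.
  by have := fg a; rewrite !ffunE; apply: codeI; exact/mem_set.
have fg0 y : val (fac f y) 0 = val (fac g y) 0.
  suff : letter_cyl f (val (fac g y) 0) y by [].
  by rewrite fgC.
apply: efpair_eq; apply/funext => y; apply: val_inj; apply/funext => i.
have := fg0 (iter i (@dyn L) y).
by rewrite !iter_dyn_factor ?iter_shift_dyn ?addn0 //; exact: fac_factor.
Qed.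

Lemma DSef_countable_mor (X Y : DSef S) :
  finite_object X -> countable [set: mor X Y].
Proof.
move=> /DSef_finite_shift[_ [Z [SZ ->]] XZ].
by apply: countable_mor_iso XZ _; exact: countable_mor_shift.
Qed.

Lemma shift_objs_countable : countable_class S -> countable_class (shift_objs S).
Proof.
move=> [code codeI].
exists (fun E => if pselect (shift_objs S E) is left h then code (sval (cid h)) else 0).
move=> E E' SE SE'; case: pselect => // h; case: pselect => // h'.
case: (cid h) => X [SX EX]; case: (cid h') => X' [SX' EX'] /= XX'.
have {}XX' := codeI _ _ SX SX' XX'; subst X'.
by rewrite EX EX' (Prop_irrelevance SX SX').
Qed.

Lemma DSef_algebroidal : countable_class S -> algebroidal (DSef S).
Proof.
move=> cS; split; last by move=> X Y /DSef_countable_mor.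
  split; first exact: DSef_mono.
    move=> L; have [A [c [AS colc]]] := DSef_shift_chain L.
    by exists A, c; split => // i; exact: shift_objs_finite.
  by move=> A _; exact: DSef_chain_colimit.
exists (shift_objs S); first exact: shift_objs_countable.
exact: DSef_finite_shift.
Qed.

Lemma DSef_universal_homogeneous : countable_class S -> (exists X, S X) ->
  (exists U : DSef S, universal (fun=> True) U /\ homogeneous (shift_objs S) U) <->
  joint_embedding (shift_objs S) /\ amalgamation (shift_objs S).
Proof.
move=> cS [X0 SX0]; apply: universal_homogeneous_iff.
- exact: DSef_mono.
- exact: shift_objs_finite.
- exact: DSef_shift_chain.
- by move=> A _; exact: DSef_chain_colimit.
- exact: shift_objs_countable.
- by move=> X Y SX _; apply: DSef_countable_mor; exact: shift_objs_finite.
- by exists (shift_obj SX0), X0, SX0.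
Qed.

(** * Joint embedding and amalgamation in terms of factor maps *)

Lemma DSef_joint_embeddingP :
  joint_embedding (shift_objs S) <->
  forall X0 X1 : shift_space, S X0 -> S X1 ->
    exists2 Y : shift_space, S Y &
      exists (f0 : shift_sys Y -> shift_sys X0) (f1 : shift_sys Y -> shift_sys X1),
        is_factor f0 /\ is_factor f1.
Proof.
split=> [JEP X0 X1 SX0 SX1|JEP _ _ [X0 [SX0 ->]] [X1 [SX1 ->]]].
  have [||_ [Y [SY ->]] [[f0] [f1]]] := JEP (shift_obj SX0) (shift_obj SX1).
  - by exists X0, SX0.
  - by exists X1, SX1.
  by exists Y => //; exists (fac f0), (fac f1); split; exact: fac_factor.
have [Y SY [f0 [f1 [Ff0 Ff1]]]] := JEP _ _ SX0 SX1.
exists (shift_obj SY); first by exists Y, SY.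
by split; [exact: (inhabits (EFPair Ff0 erefl))|exact: (inhabits (EFPair Ff1 erefl))].
Qed.

Lemma DSef_amalgamationP :
  amalgamation (shift_objs S) <->
  forall (X Y0 Y1 : shift_space)
      (f0 : shift_sys Y0 -> shift_sys X) (f1 : shift_sys Y1 -> shift_sys X),
    S X -> S Y0 -> S Y1 -> is_factor f0 -> is_factor f1 ->
    exists2 Z : shift_space, S Z &
      exists (g0 : shift_sys Z -> shift_sys Y0) (g1 : shift_sys Z -> shift_sys Y1),
        [/\ is_factor g0, is_factor g1 & f0 \o g0 = f1 \o g1].
Proof.
split=> [AP X Y0 Y1 f0 f1 SX SY0 SY1 Ff0 Ff1|AP].
  have [|||_ [Z [SZ ->]] [g0 [g1 g01]]] := AP (shift_obj SX) (shift_obj SY0)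
      (shift_obj SY1) (EFPair Ff0 erefl) (EFPair Ff1 erefl).
  - by exists X, SX.
  - by exists Y0, SY0.
  - by exists Y1, SY1.
  exists Z => //; exists (fac g0), (fac g1); split; try exact: fac_factor.
  exact: (congr1 (fun p : efpair (shift_sys X) (shift_sys Z) => fac p) g01).
move=> X' Y0' Y1' f0 f1 [X [SX XE]] [Y0 [SY0 Y0E]] [Y1 [SY1 Y1E]].
subst X' Y0' Y1'.
have [Z SZ [g0 [g1 [Fg0 Fg1 g01]]]] :=
  AP _ _ _ _ _ SX SY0 SY1 (fac_factor f0) (fac_factor f1).
exists (shift_obj SZ); first by exists Z, SZ.
by exists (EFPair Fg0 erefl), (EFPair Fg1 erefl); exact: efpair_eq.
Qed.

End DSefAlgebroidal.

Theorem theorem9p2 (S : shift_space -> Prop) (S_countable : countable_class S) :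
  [/\ algebroidal (DSef S),
      forall E : DSef S,
        finite_object E <-> exists2 X, shift_objs S X & isomorphic E X &
      (exists X : shift_space, S X) ->
        ((exists U : DSef S,
            universal (fun=> True) U /\ homogeneous (shift_objs S) U)
         <->
         (forall X0 X1 : shift_space, S X0 -> S X1 ->
            exists2 Y : shift_space, S Y &
              exists (f0 : shift_sys Y -> shift_sys X0)
                     (f1 : shift_sys Y -> shift_sys X1),
                is_factor f0 /\ is_factor f1)
         /\
         (forall (X Y0 Y1 : shift_space)
                 (f0 : shift_sys Y0 -> shift_sys X)
                 (f1 : shift_sys Y1 -> shift_sys X),
            S X -> S Y0 -> S Y1 -> is_factor f0 -> is_factor f1 ->
            exists2 Z : shift_space, S Z &
              exists (g0 : shift_sys Z -> shift_sys Y0)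
                     (g1 : shift_sys Z -> shift_sys Y1),
                [/\ is_factor g0, is_factor g1 & f0 \o g0 = f1 \o g1]))].
Proof.
split; [exact: DSef_algebroidal|exact: DSef_finiteP|move=> S0].
by rewrite -DSef_joint_embeddingP -DSef_amalgamationP; exact: DSef_universal_homogeneous.
Qed.
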